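(* Let $X$ be a compact manifold and $N$ a closed orientable manifold. Then the global sections functor $\pi_*(\mathbb{E})\mapsto\Gamma(X,\pi_*(\mathbb{E}))$ is an equivalence of categories between $\mathrm{Vect}^{\mathcal{G}}_N(X)$ and $\Gamma(V_X(N))$.
   Context: $N$ is a closed orientable Riemannian manifold. For a finite rank complex vector bundle $\mathbb{E}\to X\times N$, $\pi_*(\mathbb{E})\to X$ is the infinite rank bundle whose fiber over $b\in X$ is the space of sections of $\mathbb{E}_b=\mathbb{E}|_{\{b\}\times N}\to N$, with transition maps in the gauge group of the local model of the $\mathbb{E}_b$; these are the $\mathcal{G}$-vector bundles over $X$. $\mathrm{Vect}^{\mathcal{G}}_N(X)$ is the category of $\mathcal{G}$-vector bundles $\pi_*(\mathbb{E})$, with morphisms $\pi_*(\mathbb{E})\to\pi_*(\mathbb{F})$ those induced by bundle maps $\mathbb{E}\to\mathbb{F}$ over $X\times N$. There is a canonical identification $\Gamma(X,\pi_*(\mathbb{E}))\cong\Gamma(X\times N,\mathbb{E})$. A bundle $\mathbb{E}\in\mathrm{Vect}(X\times N)$ can be viewed as a continuous family $\{\mathbb{E}_b\to N\}_{b\in X}$ of vector bundles over $N$ parameterized by $X$; write $\{\mathbb{E}_b\}\in V_X(N)$. $\Gamma(\{\mathbb{E}_b\})$ denotes the space of maps $h:X\to\{\Gamma(N,\mathbb{E}_b)\}_{b\in X}$ such that $h(b)\in\Gamma(N,\mathbb{E}_b)$ and the family $\{h(b)\}_{b\in X}$ is the restriction of a continuous section of $\mathbb{E}\to X\times N$. $\Gamma(V_X(N))$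 is the category of all spaces of the form $\Gamma(\{\mathbb{E}_b\})$, with morphisms those induced by maps between the corresponding vector bundles over $X\times N$. *)

(* Defs.v *)
From HB Require Import structures.
From mathcomp Require Import all_boot all_order all_algebra.
From mathcomp Require Export complex.
From mathcomp Require Import all_classical all_reals all_analysis.
Import Order.TTheory GRing.Theory Num.Theory numFieldNormedType.Exports.

Set Implicit Arguments.
Unset Strict Implicit.
Unset Printing Implicit Defensive.

Local Open Scope classical_set_scope.
Local Open Scope ring_scope.

Section VectorFamilies.
Context {K : numFieldType} {B : topologicalType}.

Record total_point (F : B -> Type) := Point { base : B ; vec : F base }.

HB.instance Definition _ F := gen_eqMixin (total_point F).
HB.instance Definition _ F := gen_choiceMixin (total_point F).

(* A family of K-vector spaces over B, of arbitrary dimension, with a topology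
   on the disjoint union of the fibers. *)
Record vfamily := VFamily {
  fib :> B -> lmodType K ;
  fam_open : set_system (total_point (fun x => fib x)) ;
  fam_openT : fam_open setT ;
  fam_openI : setI_closed fam_open ;
  fam_open_bigcup : forall (I : Type) (f : I -> set (total_point (fun x => fib x))),
    (forall i, fam_open (f i)) -> fam_open (\bigcup_i f i) }.

Definition tot (E : vfamily) : Type := total_point (fun x => E x).

HB.instance Definition _ (E : vfamily) := Choice.on (tot E).
HB.instance Definition _ (E : vfamily) :=
  isOpenTopological.Build (tot E)
    (@fam_openT E) (@fam_openI E) (@fam_open_bigcup E).

Definition pt (E : vfamily) (x : B) (v : E x) : tot E := @Point (fun x => E x) x v.

Record sections (E : vfamily) := Sections {
  sec_val :> forall x, E x ;
  sec_cont : continuous (fun x => pt (sec_val x)) }.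

HB.instance Definition _ E := gen_eqMixin (sections E).
HB.instance Definition _ E := gen_choiceMixin (sections E).

Definition sec_fun (E : vfamily) (s : sections E) : {compact-open, B -> tot E} :=
  fun x => pt (s x).

HB.instance Definition _ (E : vfamily) :=
  Topological.copy (sections E) (initial_topology (@sec_fun E)).

Lemma sectionsP (E : vfamily) (s t : sections E) :
  (forall x, s x = t x) -> s = t.
Proof.
case: s t => [s cs] [t ct] /= st.
have est : s = t by apply/functional_extensionality_dep.
by rewrite est in cs *; congr Sections; exact: Prop_irrelevance.
Qed.

Definition locally_trivial (E : vfamily) := forall x : B,
  exists (k : nat) (U : set B)
    (phi : forall y, {linear 'rV[K]_k -> E y})
    (psi : forall y, E y -> 'rV[K]_k),
  [/\ open U, U x,
      forall y, U y -> cancel (phi y) (psi y) /\ cancel (psi y) (phi y),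
      forall y v, U y ->
        {for (y, v), continuous
          (fun p : B * 'rV[K]_k => pt (phi p.1 p.2))} &
      forall e : tot E, U (base e) ->
        {for e, continuous (fun e : tot E => psi (base e) (vec e))}].

(* Vector bundles of finite, locally constant, rank. *)
Record vbundle := VBundle {
  vb_fam :> vfamily ;
  vb_proj : continuous (fun e : tot vb_fam => base e) ;
  vb_triv : locally_trivial vb_fam }.

Lemma local_sec_cont (E : vbundle) (s : forall x, E x) :
  (forall x k (U : set B) (psi : forall y, E y -> 'rV[K]_k),
     (forall y, U y -> linear (psi y)) -> U x ->
     (forall r : forall y, E y, {for x, continuous (fun y => pt (r y))} ->
        (fun y => psi y (r y)) @ x --> psi x (r x)) ->
     open U -> (fun y => psi y (s y)) @ x --> psi x (s x)) ->
  continuous (fun x => pt (s x)).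
Proof.
move=> H x.
have [k [U [phi [psi [oU Ux phiK cphi cpsi]]]]] := vb_triv E x.
have psil y : U y -> linear (psi y).
  move=> /phiK[phiKy psiKy] a u v.
  by rewrite -{1}(psiKy u) -{1}(psiKy v) -linearP phiKy.
have cpsiE (r : forall y, E y) : {for x, continuous (fun y => pt (r y))} ->
    (fun y => psi y (r y)) @ x --> psi x (r x).
  move=> cr.
  exact: (@continuous_comp _ _ _ (fun y => pt (r y))
      (fun e : tot E => psi (base e) (vec e)) x cr (cpsi (pt (r x)) Ux)).
have cw := H x k U psi psil Ux cpsiE oU.
have wE y : U y -> phi y (psi y (s y)) = s y by move=> /phiK[_ ->].
rewrite /prop_for /continuous_at -(wE x Ux).
apply: cvg_trans.
  apply: (@near_eq_cvg _ _ _ _ (fun y => pt (phi y (psi y (s y))))).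
  by apply: filterS (open_nbhs_nbhs (conj oU Ux)) => y Uy; rewrite wE.
apply: (@continuous_comp _ _ _ (fun y => (y, psi y (s y)))
  (fun p : B * 'rV[K]_k => pt (phi p.1 p.2)) x _ (cphi _ _ Ux)).
exact: (cvg_pair cvg_id cw).
Qed.

Section SectionSpace.
Variable E : vbundle.

Lemma zero_sec_cont : continuous (fun x => pt (0 : E x)).
Proof.
apply: local_sec_cont => x k U psi psil Ux _ oU.
have psi0 y : U y -> psi y 0 = 0.
  move=> /psil/(_ 1 0 0); rewrite !scale1r addr0 => /esym/eqP.
  by rewrite -subr_eq0 addrK => /eqP.
rewrite psi0//; apply: cvg_trans (@cvg_cst _ (0 : 'rV[K]_k) _ (nbhs x) _).
apply: near_eq_cvg.
by apply: filterS (open_nbhs_nbhs (conj oU Ux)) => y Uy; rewrite psi0.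
Qed.

Lemma lin_sec_cont (a : K) (s t : sections E) :
  continuous (fun x => pt (a *: s x + t x)).
Proof.
apply: local_sec_cont => x k U psi psil Ux cpsiE oU.
rewrite (psil x Ux).
apply: cvg_trans.
  apply: (@near_eq_cvg _ _ _ _ (fun y => a *: psi y (s y) + psi y (t y))).
  by apply: filterS (open_nbhs_nbhs (conj oU Ux)) => y Uy; rewrite psil.
exact: (cvgD (cvgZl_tmp (cpsiE _ (@sec_cont _ s x)))
             (cpsiE _ (@sec_cont _ t x))).
Qed.

Definition sec_zero : sections E := Sections zero_sec_cont.
Definition sec_lin (a : K) (s t : sections E) : sections E :=
  Sections (@lin_sec_cont a s t).
Definition sec_add (s t : sections E) : sections E := sec_lin 1 s t.
Definition sec_scale (a : K) (s : sections E) : sections E :=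
  sec_lin a s sec_zero.
Definition sec_opp (s : sections E) : sections E := sec_scale (- 1) s.

Lemma sec_addA : associative sec_add.
Proof. by move=> s t u; apply: sectionsP => x /=; rewrite !scale1r addrA. Qed.
Lemma sec_addC : commutative sec_add.
Proof. by move=> s t; apply: sectionsP => x /=; rewrite !scale1r addrC. Qed.
Lemma sec_add0 : left_id sec_zero sec_add.
Proof. by move=> s; apply: sectionsP => x /=; rewrite scaler0 add0r. Qed.
Lemma sec_addN : left_inverse sec_zero sec_opp sec_add.
Proof.
by move=> s; apply: sectionsP => x /=; rewrite scale1r addr0 scaleN1r addNr.
Qed.

HB.instance Definition _ :=
  GRing.isZmodule.Build (sections E) sec_addA sec_addC sec_add0 sec_addN.

Lemma sec_scaleA a b s : sec_scale a (sec_scale b s) = sec_scale (a * b) s.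
Proof. by apply: sectionsP => x /=; rewrite !addr0 scalerA. Qed.
Lemma sec_scale1 : left_id 1 sec_scale.
Proof. by move=> s; apply: sectionsP => x /=; rewrite addr0 scale1r. Qed.
Lemma sec_scaleDr : right_distributive sec_scale +%R.
Proof.
by move=> a s t; apply: sectionsP => x /=; rewrite !addr0 !scale1r scalerDr.
Qed.
Lemma sec_scaleDl s : {morph sec_scale^~ s : a b / a + b}.
Proof.
by move=> a b; apply: sectionsP => x /=; rewrite !addr0 scale1r scalerDl.
Qed.

HB.instance Definition _ := GRing.Zmodule_isLmodule.Build K (sections E)
  sec_scaleA sec_scale1 sec_scaleDr sec_scaleDl.

Lemma secDE (s t : sections E) x : (s + t) x = s x + t x.
Proof. by rewrite /= scale1r. Qed.
Lemma secZE a (s : sections E) x : (a *: s) x = a *: s x.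
Proof. by rewrite /= addr0. Qed.

End SectionSpace.

(* Morphisms of bundles over the identity of B. *)
Record bundle_map (E F : vbundle) := BundleMap {
  bm_val :> forall x, {linear E x -> F x} ;
  bm_cont : continuous (fun e : tot E => pt (bm_val (base e) (vec e))) }.

Lemma bm_sec_cont (E F : vbundle) (f : bundle_map E F) (s : sections E) :
  continuous (fun x => pt (f x (s x))).
Proof.
by move=> x; apply: (continuous_comp (@sec_cont _ s x) (@bm_cont _ _ f _)).
Qed.

Definition bm_sec (E F : vbundle) (f : bundle_map E F) (s : sections E) :
  sections F := Sections (@bm_sec_cont _ _ f s).

Lemma bm_id_cont (E : vbundle) :
  continuous (fun e : tot E => pt ((idfun : {linear E (base e) -> E (base e)}) (vec e))).
Proof.
rewrite (_ : (fun e => _) = id); first by move=> e; exact: cvg_id.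
by apply/funext; case.
Qed.

Definition bm_id (E : vbundle) : bundle_map E E :=
  BundleMap (bm_val := fun x => idfun) (@bm_id_cont E).

Lemma bm_comp_cont (E F G : vbundle) (g : bundle_map F G) (f : bundle_map E F) :
  continuous (fun e : tot E => pt ((g (base e) \o f (base e)) (vec e))).
Proof.
by move=> e; apply: (continuous_comp (@bm_cont _ _ f e) (@bm_cont _ _ g _)).
Qed.

Definition bm_comp (E F G : vbundle) (g : bundle_map F G) (f : bundle_map E F) :
  bundle_map E G :=
  BundleMap (bm_val := fun x => g x \o f x) (@bm_comp_cont _ _ _ g f).

End VectorFamilies.
Arguments vfamily : clear implicits.
Arguments vbundle : clear implicits.

Section Pullback.
Context {K : numFieldType} {B B' : topologicalType}.
Variables (f : B' -> B) (cf : continuous f) (E : vbundle K B).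

Definition pb_incl (e : total_point (fun y => E (f y))) : B' * tot E :=
  (base e, @pt _ _ E (f (base e)) (vec e)).

Definition pb_open : set_system (total_point (fun y => E (f y))) :=
  @open (initial_topology pb_incl).

Lemma pb_openT : pb_open setT. Proof. exact: openT. Qed.
Lemma pb_openI : setI_closed pb_open. Proof. by move=> ? ?; exact: openI. Qed.
Lemma pb_open_bigcup (I : Type) (g : I -> set (total_point (fun y => E (f y)))) :
  (forall i, pb_open (g i)) -> pb_open (\bigcup_i g i).
Proof. by move=> og; apply: bigcup_open => i _; exact: og. Qed.

Definition pb_fam : vfamily K B' :=
  VFamily (fib := fun y => E (f y)) pb_openT pb_openI pb_open_bigcup.

Lemma pb_incl_cont : continuous (pb_incl : tot pb_fam -> B' * tot E).
Proof. by apply/continuousP => A oA; exists A. Qed.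

Lemma pb_proj : continuous (fun e : tot pb_fam => base e).
Proof.
move=> e; exact: (continuous_comp (@pb_incl_cont e) (@cvg_fst _ _ _ _ _)).
Qed.

Lemma pb_lift : continuous (fun e : tot pb_fam => @pt _ _ E (f (base e)) (vec e)).
Proof.
move=> e; exact: (continuous_comp (@pb_incl_cont e) (@cvg_snd _ _ _ _ _)).
Qed.

Lemma pb_into (T : topologicalType) (g : T -> tot pb_fam) (x : T) :
  {for x, continuous (fun y => base (g y))} ->
  {for x, continuous (fun y => @pt _ _ E (f (base (g y))) (vec (g y)))} ->
  {for x, continuous g}.
Proof.
move=> c1 c2 A [W [[V oV <-] Vgx sVA]].
have cg : (fun y => pb_incl (g y)) @ x --> pb_incl (g x).
  exact: (cvg_pair c1 c2).
apply: (@filterS _ (nbhs x) _ _ _ _ (cg V (open_nbhs_nbhs (conj oV Vgx)))) => y Vy.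
exact: sVA.
Qed.

Lemma pb_triv : locally_trivial pb_fam.
Proof.
move=> x; have [k [U [phi [psi [oU Ux phiK cphi cpsi]]]]] := vb_triv E (f x).
exists k, (f @^-1` U), (fun y => phi (f y)), (fun y => psi (f y)); split=> //.
- by apply: open_comp => // y _; exact: cf.
- by move=> y Uy; exact: phiK.
- move=> y v Uy; apply: pb_into => /=; first exact: cvg_fst.
  apply: (@continuous_comp _ _ _ (fun p : B' * 'rV[K]_k => (f p.1, p.2))
    (fun p : B * 'rV[K]_k => pt (phi p.1 p.2)) (y, v) _ (cphi _ _ Uy)).
  apply: (@cvg_pair _ _ _ _ (nbhs (f y)) (nbhs v)); last exact: cvg_snd.
  exact: (@continuous_comp _ _ _ fst f (y, v)
           (@cvg_fst _ _ (nbhs y) (nbhs v) _) (@cf y)).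
- move=> e Ue; exact: (@continuous_comp _ _ _ (fun e : tot pb_fam => @pt _ _ E (f (base e)) (vec e))
    (fun e : tot E => psi (base e) (vec e)) e (@pb_lift e) (cpsi (@pt _ _ E (f (base e)) (vec e)) Ue)).
Qed.

Definition pullback : vbundle K B' := VBundle pb_proj pb_triv.

End Pullback.

Section Pushforward.
Context {K : numFieldType} {X N : topologicalType}.

Lemma slice_cont (b : X) : continuous (fun n : N => (b, n)).
Proof. by move=> n; apply: cvg_pair; [exact: cvg_cst | exact: cvg_id]. Qed.

(* E_b, the restriction of E to {b} x N. *)
Definition slice (E : vbundle K (X * N)%type) (b : X) : vbundle K N :=
  pullback (@slice_cont b) E.

(* A bundle isomorphism from the restriction to U x N of the constant family
   with fiber the local model E0 -> N to the restriction of E. *)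
Record gauge_chart (E : vbundle K (X * N)%type) (E0 : vbundle K N) := GaugeChart {
  gc_dom : set X ;
  gc_map : forall x : X * N, {linear E0 x.2 -> E x} ;
  gc_inv : forall x : X * N, E x -> E0 x.2 ;
  gc_open : open gc_dom ;
  gc_mapK : forall x, gc_dom x.1 ->
    cancel (gc_map x) (@gc_inv x) /\ cancel (@gc_inv x) (gc_map x) ;
  gc_map_cont : forall b (e : tot E0), gc_dom b ->
    {for (b, e), continuous
      (fun p : X * tot E0 => pt (gc_map (p.1, base p.2) (vec p.2)))} ;
  gc_inv_cont : forall e : tot E, gc_dom (base e).1 ->
    {for e, continuous (fun e : tot E => pt (gc_inv (vec e)))} }.

(* The inverse image of W under the map (b, s) |-> (b, c_b o s) from
   U x Gamma(N, E0) to the disjoint union of the Gamma(N, E_b). *)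
Definition chart_preimage (E : vbundle K (X * N)%type) (E0 : vbundle K N)
    (c : gauge_chart E E0) (W : set (total_point (fun b => sections (slice E b)))) :
    set (X * sections E0) :=
  [set p : X * sections E0 | gc_dom c p.1 /\ exists t : sections (slice E p.1),
     (forall n, t n = gc_map c (p.1, n) (p.2 n)) /\ W (@Point _ (fun b => sections (slice E b)) p.1 t)].

(* The topology of pi_*(E): the final topology for the charts
   U x Gamma(N, E0) -> pi_*(E), where Gamma(N, E0) has the compact-open topology.
   For two charts with the same model these maps differ by the map from the
   overlap to the gauge group of E0 given by b |-> c'_b^-1 o c_b. *)
Definition push_open (E : vbundle K (X * N)%type) :
    set_system (total_point (fun b => sections (slice E b))) :=
  [set W | forall (E0 : vbundle K N) (c : gauge_chart E E0),
     open (chart_preimage c W)].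
Arguments push_open : clear implicits.

Section PushforwardTopology.
Variable E : vbundle K (X * N)%type.

Lemma chart_sec_cont (E0 : vbundle K N) (c : gauge_chart E E0) b (s : sections E0) :
  gc_dom c b -> continuous (fun n => @pt _ _ (slice E b) n (gc_map c (b, n) (s n))).
Proof.
move=> Ub n; apply: pb_into => /=; first exact: cvg_id.
apply: (@continuous_comp _ _ _ (fun n => (b, pt (s n)))
  (fun p : X * tot E0 => pt (gc_map c (p.1, base p.2) (vec p.2))) n _
  (@gc_map_cont _ _ c b (pt (s n)) Ub)).
apply: (@cvg_pair _ _ _ _ (nbhs b) (nbhs (pt (s n)))); first exact: cvg_cst.
exact: sec_cont.
Qed.

Lemma push_openT : push_open E setT.
Proof.
move=> E0 c; rewrite (_ : chart_preimage _ _ = fst @^-1` gc_dom c).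
  by apply: open_comp => [p _|]; [exact: cvg_fst | exact: gc_open].
apply/seteqP; split=> [[b s] [Ub _]//|[b s] /= Ub]; split=> //=.
by exists (Sections (@chart_sec_cont _ c b s Ub)).
Qed.

Lemma push_openI : setI_closed (push_open E).
Proof.
move=> W W' oW oW' E0 c.
rewrite (_ : chart_preimage _ _ = chart_preimage c W `&` chart_preimage c W').
  by apply: openI; [exact: oW | exact: oW'].
apply/seteqP; split=> [[b s] /= [Ub [t [tE [Wt W't]]]]|].
  by split; split=> //; exists t.
move=> [b s] /= [[Ub [t [tE Wt]]] [_ [t' [t'E W't']]]]; split=> //.
exists t; split=> //; split=> //.
by rewrite (_ : t = t')//; apply: sectionsP => n; rewrite tE t'E.
Qed.

Lemma push_open_bigcup (I : Type)
    (f : I -> set (total_point (fun b => sections (slice E b)))) :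
  (forall i, push_open E (f i)) -> push_open E (\bigcup_i f i).
Proof.
move=> of_ E0 c.
rewrite (_ : chart_preimage _ _ = \bigcup_i chart_preimage c (f i)).
  by apply: bigcup_open => i _; exact: of_.
apply/seteqP; split=> [[b s] /= [Ub [t [tE [i _ fit]]]]|].
  by exists i => //; split=> //; exists t.
move=> [b s] [i _ [/= Ub [t [tE fit]]]]; split=> //.
by exists t; split=> //; exists i.
Qed.

(* pi_*(E). *)
Definition pushforward : vfamily K X :=
  VFamily (fib := fun b => sections (slice E b))
    push_openT push_openI push_open_bigcup.

(* Gamma(X, pi_*(E)). *)
Definition push_sections : set (forall b, sections (slice E b)) :=
  [set h | continuous (fun b => @pt _ _ pushforward b (h b))].

(* Gamma({E_b}). *)
Definition family_sections : set (forall b, sections (slice E b)) :=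
  [set h | exists sigma : sections E, forall b n, h b n = sigma (b, n)].

End PushforwardTopology.

Lemma bm_slice_cont (E F : vbundle K (X * N)%type) (phi : bundle_map E F) b :
  continuous (fun e : tot (slice E b) =>
    @pt _ _ (slice F b) (base e) (phi (b, base e) (vec e))).
Proof.
move=> e; apply: pb_into => /=; first exact: (@vb_proj _ _ (slice E b) e).
exact: (@continuous_comp _ _ _
  (fun e : tot (slice E b) => @pt _ _ E (b, base e) (vec e))
  (fun e : tot E => pt (phi (base e) (vec e))) e
  (@pb_lift _ _ _ (fun n => (b, n)) E e) (@bm_cont _ _ _ _ phi _)).
Qed.

(* The restriction E_b -> F_b of a bundle map E -> F. *)
Definition bm_slice (E F : vbundle K (X * N)%type) (phi : bundle_map E F) b :
  bundle_map (slice E b) (slice F b) :=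
  @BundleMap _ _ (slice E b) (slice F b) (fun n => phi (b, n)) (@bm_slice_cont E F phi b).

(* pi_*(phi). *)
Definition push_map (E F : vbundle K (X * N)%type) (phi : bundle_map E F) b :
  sections (slice E b) -> sections (slice F b) := bm_sec (bm_slice phi b).

End Pushforward.
Arguments push_sections {K X N} E _.
Arguments family_sections {K X N} E _.
Arguments push_map {K X N E F} phi b s.

Record category := Category {
  ob :> Type ;
  hom : ob -> ob -> Type ;
  idm : forall a, hom a a ;
  comp : forall a b c, hom b c -> hom a b -> hom a c ;
  comp1m : forall a b (f : hom a b), comp (idm b) f = f ;
  compm1 : forall a b (f : hom a b), comp f (idm a) = f ;
  compA : forall a b c d (h : hom c d) (g : hom b c) (f : hom a b),
    comp h (comp g f) = comp (comp h g) f }.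

Record functor (C D : category) := Functor {
  fob :> C -> D ;
  fmap : forall a b, hom a b -> hom (fob a) (fob b) ;
  fmap1 : forall a, fmap (idm a) = idm (fob a) ;
  fmapM : forall a b c (g : hom b c) (f : hom a b),
    fmap (comp g f) = comp (fmap g) (fmap f) }.

Definition functor_id (C : category) : functor C C :=
  @Functor C C id (fun _ _ f => f) (fun _ => erefl) (fun _ _ _ _ _ => erefl).

Section FunctorComp.
Context {C D E : category} (G : functor D E) (F : functor C D).
Let gf a b (f : hom a b) := fmap G (fmap F f).
Lemma functor_comp1 a : gf (idm a) = idm (G (F a)).
Proof. by rewrite /gf !fmap1. Qed.
Lemma functor_compM a b c (g : hom b c) (f : hom a b) :
  gf (comp g f) = comp (gf g) (gf f).
Proof. by rewrite /gf !fmapM. Qed.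
Definition functor_comp : functor C E := Functor functor_comp1 functor_compM.
End FunctorComp.

Definition naturally_isomorphic (C D : category) (F G : functor C D) :=
  exists (eta : forall a, hom (F a) (G a)) (eta' : forall a, hom (G a) (F a)),
    (forall a, comp (eta' a) (eta a) = idm (F a) /\
               comp (eta a) (eta' a) = idm (G a)) /\
    (forall a b (f : hom a b), comp (eta b) (fmap F f) = comp (fmap G f) (eta a)).

Definition is_equivalence (C D : category) (F : functor C D) :=
  exists G : functor D C,
    naturally_isomorphic (functor_comp G F) (functor_id C) /\
    naturally_isomorphic (functor_comp F G) (functor_id D).

Section Categories.
Context {K : numFieldType} {X N : topologicalType}.
Implicit Types E F G : vbundle K (X * N)%type.

(* Maps pi_*(E) -> pi_*(F) over X; fiberwise linearity follows from ghom_ind. *)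
Record ghom E F := GHom {
  ghom_val :> forall b, sections (slice E b) -> sections (slice F b) ;
  ghom_ind : exists phi : bundle_map E F, forall b s, @ghom_val b s = push_map phi b s }.
Arguments ghom_val {E F} g b s.

Lemma ghomP E F (f g : ghom E F) : (forall b s, f b s = g b s) -> f = g.
Proof.
case: f g => [f pf] [g pg] /= fg.
have efg : f = g.
  apply/functional_extensionality_dep => b.
  by apply/functional_extensionality_dep => s; exact: fg.
by rewrite efg in pf *; congr GHom; exact: Prop_irrelevance.
Qed.

Lemma ghom_id_ind E :
  exists phi : bundle_map E E, forall b (s : sections (slice E b)), s = push_map phi b s.
Proof. by exists (bm_id E) => b s; apply: sectionsP. Qed.

Definition ghom_id E : ghom E E := GHom (ghom_val := fun b s => s) (ghom_id_ind E).

Lemma ghom_comp_ind E F G (g : ghom F G) (f : ghom E F) :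
  exists phi : bundle_map E G, forall b s, g b (f b s) = push_map phi b s.
Proof.
have [psi gE] := ghom_ind g; have [phi fE] := ghom_ind f.
exists (bm_comp psi phi) => b s; rewrite gE fE.
by apply: sectionsP.
Qed.

Definition ghom_comp E F G (g : ghom F G) (f : ghom E F) : ghom E G :=
  GHom (ghom_val := fun b s => g b (f b s)) (ghom_comp_ind g f).

Lemma ghom_comp1m E F (f : ghom E F) : ghom_comp (ghom_id F) f = f.
Proof. exact: ghomP. Qed.
Lemma ghom_compm1 E F (f : ghom E F) : ghom_comp f (ghom_id E) = f.
Proof. exact: ghomP. Qed.
Lemma ghom_compA E F G H (h : ghom G H) (g : ghom F G) (f : ghom E F) :
  ghom_comp h (ghom_comp g f) = ghom_comp (ghom_comp h g) f.
Proof. exact: ghomP. Qed.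

(* Vect^G_N(X); the object E stands for pi_*(E). *)
Definition VectG : category := Category ghom_comp1m ghom_compm1 ghom_compA.

(* A space equal to Gamma({E_b}), remembering the bundle E. *)
Record gspace := GSpace {
  gs_bundle : vbundle K (X * N)%type ;
  gs_space : set (forall b, sections (slice gs_bundle b)) ;
  gs_spaceE : gs_space = family_sections gs_bundle }.
Arguments gs_space : clear implicits.

Definition gs_elt (S : gspace) := {h | gs_space S h}.

Lemma gs_eltP S (h h' : gs_elt S) : proj1_sig h = proj1_sig h' -> h = h'.
Proof.
by case: h h' => [h p] [h' p'] /= hh'; subst h'; congr exist; exact: Prop_irrelevance.
Qed.

Definition gs_induced (S T : gspace) (f : gs_elt S -> gs_elt T) :=
  exists phi : bundle_map (gs_bundle S) (gs_bundle T),
    forall h b, proj1_sig (f h) b = push_map phi b (proj1_sig h b).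

(* Linearity follows from gs_ind. *)
Record gshom (S T : gspace) := GSHom {
  gs_val :> gs_elt S -> gs_elt T ;
  gs_ind : gs_induced gs_val }.

Lemma gshomP S T (f g : gshom S T) : (forall h, f h = g h) -> f = g.
Proof.
case: f g => [f pf] [g pg] /= fg.
have efg : f = g by apply/funext.
by rewrite efg in pf *; congr GSHom; exact: Prop_irrelevance.
Qed.

Lemma gshom_id_ind S : gs_induced (id : gs_elt S -> gs_elt S).
Proof. by exists (bm_id _) => h b; apply: sectionsP. Qed.

Definition gshom_id S : gshom S S := GSHom (@gshom_id_ind S).

Lemma gshom_comp_ind S T U (g : gshom T U) (f : gshom S T) :
  gs_induced (fun h => g (f h)).
Proof.
have [psi gE] := gs_ind g; have [phi fE] := gs_ind f.
exists (bm_comp psi phi) => h b; rewrite gE fE.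
by apply: sectionsP.
Qed.

Definition gshom_comp S T U (g : gshom T U) (f : gshom S T) : gshom S U :=
  GSHom (@gshom_comp_ind S T U g f).

Lemma gshom_comp1m S T (f : gshom S T) : gshom_comp (gshom_id T) f = f.
Proof. exact: gshomP. Qed.
Lemma gshom_compm1 S T (f : gshom S T) : gshom_comp f (gshom_id S) = f.
Proof. exact: gshomP. Qed.
Lemma gshom_compA S T U V (h : gshom U V) (g : gshom T U) (f : gshom S T) :
  gshom_comp h (gshom_comp g f) = gshom_comp (gshom_comp h g) f.
Proof. exact: gshomP. Qed.

(* Gamma(V_X(N)). *)
Definition GammaV : category := Category gshom_comp1m gshom_compm1 gshom_compA.

(* The canonical identification of Gamma(X, pi_*(E)) with Gamma(X x N, E), the
   latter seen as the set of families Gamma({E_b}). *)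
Definition canonical_identification :=
  forall E, push_sections E = family_sections E.

Section GlobalSections.
Hypothesis ident : canonical_identification.

Definition global_sections_ob E : gspace :=
  GSpace (gs_bundle := E) (gs_space := push_sections E) (ident E).

Lemma global_sections_map_subproof E F (f : ghom E F) (h : gs_elt (global_sections_ob E)) :
  push_sections F (fun b => f b (proj1_sig h b)).
Proof.
case: h => h /=; rewrite !ident => -[sigma hE].
have [phi fE] := ghom_ind f.
by exists (bm_sec phi sigma) => b n; rewrite fE /= hE.
Qed.

Definition global_sections_fun E F (f : ghom E F) (h : gs_elt (global_sections_ob E)) :
    gs_elt (global_sections_ob F) :=
  exist _ (fun b => f b (proj1_sig h b)) (@global_sections_map_subproof E F f h).

Lemma global_sections_ind E F (f : ghom E F) : gs_induced (global_sections_fun f).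
Proof. by have [phi fE] := ghom_ind f; exists phi => h b; rewrite /= fE. Qed.

Definition global_sections_map E F (f : ghom E F) :
    gshom (global_sections_ob E) (global_sections_ob F) :=
  GSHom (global_sections_ind f).

Lemma global_sections_map1 E :
  global_sections_map (ghom_id E) = gshom_id (global_sections_ob E).
Proof. by apply: gshomP => h; exact: gs_eltP. Qed.

Lemma global_sections_mapM E F G (g : ghom F G) (f : ghom E F) :
  global_sections_map (ghom_comp g f) =
  gshom_comp (global_sections_map g) (global_sections_map f).
Proof. by apply: gshomP => h; exact: gs_eltP. Qed.

(* The functor pi_*(E) |-> Gamma(X, pi_*(E)); the identification is what places
   Gamma(X, pi_*(E)) among the spaces Gamma({E_b}). *)
Definition global_sections : functor VectG GammaV :=
  @Functor VectG GammaV global_sections_ob global_sections_map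
    global_sections_map1 global_sections_mapM.

End GlobalSections.
End Categories.
Arguments VectG : clear implicits.
Arguments GammaV : clear implicits.
Arguments canonical_identification : clear implicits.

Section Manifolds.
Context {R : realType}.

Definition half_space d : set 'rV[R]_d :=
  [set p | forall i : 'I_d, i = 0%N :> nat -> 0 <= p ord0 i].
Arguments half_space : clear implicits.

(* Topological manifold of dimension d with (possibly empty) boundary. *)
Definition manifold_with_boundary d (M : topologicalType) :=
  [/\ hausdorff_space M, @second_countable M &
      forall x : M, exists (U : set M) (V : set 'rV[R]_d)
        (f : M -> 'rV[R]_d) (g : 'rV[R]_d -> M),
      [/\ open U /\ U x, open V /\ f @` U = V `&` half_space d,
          forall y, U y -> g (f y) = y,
          {within U, continuous f} &
          {within V `&` half_space d, continuous g}] ].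

Fixpoint class_C (k : nat) m (V : normedModType R) (U : set 'rV[R]_m)
    (f : 'rV[R]_m -> V) : Prop :=
  (forall p, U p -> {for p, continuous f}) /\
  if k is k'.+1 then
    forall i, (forall p, U p -> derivable f p (delta_mx ord0 i)) /\
      class_C k' U (fun p => 'D_(delta_mx ord0 i) f p)
  else True.

(* To be used with U open. *)
Definition smooth_on m (V : normedModType R) (U : set 'rV[R]_m)
    (f : 'rV[R]_m -> V) := forall k, class_C k U f.

Record chart m (M : topologicalType) := Chart {
  ch_dom : set M ;
  ch_map : M -> 'rV[R]_m ;
  ch_inv : 'rV[R]_m -> M ;
  ch_dom_open : open ch_dom ;
  ch_im_open : open (ch_map @` ch_dom) ;
  ch_mapK : forall x, ch_dom x -> ch_inv (ch_map x) = x ;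
  ch_map_cont : forall x, ch_dom x -> {for x, continuous ch_map} ;
  ch_inv_cont : forall p, (ch_map @` ch_dom) p -> {for p, continuous ch_inv} }.

Definition overlap m (M : topologicalType) (c c' : chart m M) : set 'rV[R]_m :=
  ch_map c @` (ch_dom c `&` ch_dom c').

Definition transition m (M : topologicalType) (c c' : chart m M)
    (p : 'rV[R]_m) : 'rV[R]_m := ch_map c' (ch_inv c p).

Definition covering m (M : topologicalType) (A : set (chart m M)) :=
  forall x, exists2 c, A c & ch_dom c x.

Definition smoothly_compatible m (M : topologicalType) (A A' : set (chart m M)) :=
  forall c c', A c -> A' c' -> smooth_on (overlap c c') (transition c c') /\
                               smooth_on (overlap c' c) (transition c' c).

(* Smooth manifold without boundary with a Riemannian metric; rm_metric c is the
   Gram matrix of the metric in the chart c. Jacobian matrices act on row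
   vectors: the differential of f at p is v |-> v *m 'J f p. *)
Record riemannian_manifold m (M : topologicalType) := RiemannianManifold {
  rm_hausdorff : hausdorff_space M ;
  rm_second_countable : @second_countable M ;
  rm_atlas : set (chart m M) ;
  rm_covering : covering rm_atlas ;
  rm_smooth : smoothly_compatible rm_atlas rm_atlas ;
  rm_metric : chart m M -> 'rV[R]_m -> 'M[R]_m ;
  rm_metric_smooth : forall c, rm_atlas c ->
    smooth_on (ch_map c @` ch_dom c) (rm_metric c) ;
  rm_metric_sym : forall c p, rm_atlas c -> (ch_map c @` ch_dom c) p ->
    (rm_metric c p)^T = rm_metric c p ;
  rm_metric_pos : forall c p, rm_atlas c -> (ch_map c @` ch_dom c) p ->
    forall v : 'rV[R]_m, v != 0 ->
      0 < (v *m rm_metric c p *m v^T) ord0 ord0 ;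
  rm_metric_change : forall c c' p, rm_atlas c -> rm_atlas c' -> overlap c c' p ->
    rm_metric c p = jacobian (transition c c') p *m
      rm_metric c' (transition c c' p) *m (jacobian (transition c c') p)^T }.

(* The smooth structure has an oriented atlas. *)
Definition orientable m (M : topologicalType) (g : riemannian_manifold m M) :=
  exists A : set (chart m M),
    [/\ covering A, smoothly_compatible A (rm_atlas g), smoothly_compatible A A &
        forall c c' p, A c -> A c' -> overlap c c' p ->
          0 < \det (jacobian (transition c c') p)].

End Manifolds.
Arguments manifold_with_boundary : clear implicits.
Arguments riemannian_manifold : clear implicits.

(* Main.v *)
(* Both inclusions of the identification rest on the topology of pi_*(E) being
   final for the gauge charts.  A continuous h : X -> pi_*(E) is jointly
   continuous because, for C compact in N and Q open in E, the sections mapping C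
   into Q form an open set in every chart, evaluation being continuous on the
   compact Hausdorff N.  Conversely, a section of E is a continuous map to
   pi_*(E) as soon as every b in X lies in the domain of a chart: cover {b} x N by
   trivializations of E and sum, with bump functions, the resulting maps
   E_(b,n) -> E_(b',n).  The sum is a positive multiple of the identity on
   {b} x N, hence bijective on U x N for some neighborhood U of b, by the tube
   lemma.

   For the equivalence, bump functions extend every vector of E to a global
   section, so the map induced on global sections determines the bundle map;
   forgetting the space and keeping the bundle is then a functor, inverse to the
   global sections functor up to natural isomorphism. *)

From HB Require Import structures.
Require Import Defs.
From mathcomp Require Import all_boot all_order all_algebra.
From mathcomp Require Import all_classical all_reals all_analysis.
Import Order.TTheory GRing.Theory Num.Theory numFieldNormedType.Exports.

Set Implicit Arguments.
Unset Strict Implicit.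
Unset Printing Implicit Defensive.

Local Open Scope classical_set_scope.
Local Open Scope complex_scope.
Local Open Scope ring_scope.

(** * Bump functions on compact Hausdorff spaces *)

(** Vanishing off a closed [C] inside [U], rather than merely off [U], lets data given on [U] be
    extended by zero continuously. Nonnegative values cannot cancel in sums. *)
Definition bump_functions (K : numFieldType) (T : topologicalType) :=
  forall (x : T) (U : set T), nbhs x U -> exists (f : T -> K) (C : set T),
    [/\ continuous f, forall y, 0 <= f y, 0 < f x, closed C & C `<=` U /\
        forall y, ~ C y -> f y = 0].

Lemma hausdorff_setX (T U : topologicalType) :
  hausdorff_space T -> hausdorff_space U -> hausdorff_space (T * U)%type.
Proof.
move=> hT hU [a b] [a' b'] cl; congr pair.
- apply: hT => A B Aa Ba.
  have [||y [[Ay _] [By _]]] := cl (A `*` setT) (B `*` setT).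
  + by exists (A, setT) => //; split=> //; exact: filterT.
  + by exists (B, setT) => //; split=> //; exact: filterT.
  + by exists y.1.
- apply: hU => A B Aa Ba.
  have [||y [[_ Ay] [_ By]]] := cl (setT `*` A) (setT `*` B).
  + by exists (setT, A) => //; split=> //; exact: filterT.
  + by exists (setT, B) => //; split=> //; exact: filterT.
  + by exists y.2.
Qed.

Lemma real_complex_continuous (R : realType) :
  continuous (fun x : R => x%:C : (R[i] : numFieldType)).
Proof.
(* A positive element of [R[i]] has zero imaginary part, so the estimate takes place in [R]. *)
move=> x; apply/cvgrPdist_lt => -[e e'] /=; rewrite ltcE/= => /andP[/eqP -> e0].
near=> y; rewrite -rmorphB normc_def/= expr0n/= addr0 sqrtr_sqr ltcR.
near: y; exact: cvgr_dist_lt.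
Unshelve. all: by end_near. Qed.

Lemma compact_bump_functions (R : realType) (T : topologicalType) :
  hausdorff_space T -> compact [set: T] ->
  bump_functions (R[i] : numFieldType) T.
Proof.
move=> hT cT x U Ux.
have [V Vx VU] := compact_regular hT cT filterT Ux.
(* Urysohn's lemma: the function is 1 at [x] and 0 off the interior of [closure V], hence off
   [closure V]. *)
have sep : uniform_separator (~` (closure V)°) [set x].
  apply: ((@normal_separatorP R T).1 (@compact_normal T hT cT)).
  - exact/open_closedC/open_interior.
  - exact/accessible_closed_set1/hausdorff_accessible.
  - rewrite -subset0 => y [/= + yx]; rewrite yx; apply.
    by apply: filterS Vx; exact: subset_closure.
have [f [cf f01 f0 f1]] := (@uniform_separatorP _ R _ _).1 sep.
exists (fun y => (f y)%:C), (closure V); split => //.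
- move=> y; apply: (@continuous_comp _ _ _ f (fun t : R => t%:C : (R[i] : numFieldType)) y (cf y)).
  exact: real_complex_continuous.
- move=> y; rewrite lecR.
  have : `[0, 1]%classic (f y) by apply: f01; exists y.
  by rewrite /= in_itv/= => /andP[].
- by rewrite ltcR (f1 (f x)) ?ltr01//; exists x.
- exact: closed_closure.
split=> // y Vy; rewrite (f0 (f y))//; exists y => // /interior_subset.
by [].
Qed.

(** * Continuity of matrix operations *)

Section MatrixLimits.
Context {K : numFieldType} {T : Type} {F : set_system T} {FF : Filter F}.

Lemma cvg_mx m n (M : T -> 'M[K]_(m, n)) (L : 'M[K]_(m, n)) :
  (forall i j, (fun t => M t i j) @ F --> L i j) <-> M @ F --> L.
Proof.
split=> [ML A [P LP PA]|ML i j].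
- have : \forall t \near F, forall i j, P i j (M t i j).
    by apply: filter_forall => i; apply: filter_forall => j; exact: (ML i j).
  by apply: filterS => t MP; exact: PA.
- apply: (@cvg_comp _ _ _ M (fun A : 'M[K]_(m, n) => A i j) F _ _ ML).
  exact: coord_continuous.
Qed.

Lemma cvg_mulmx m n p (M : T -> 'M[K]_(m, n)) (M' : T -> 'M[K]_(n, p))
    (L : 'M[K]_(m, n)) (L' : 'M[K]_(n, p)) :
  M @ F --> L -> M' @ F --> L' -> (fun t => M t *m M' t) @ F --> L *m L'.
Proof.
move=> /cvg_mx ML /cvg_mx ML'; apply/cvg_mx => i j; rewrite mxE.
under eq_cvg do rewrite mxE.
by apply: cvg_big => [|k _]; [exact: add_continuous | exact: cvgM].
Qed.

Lemma cvg_det n (M : T -> 'M[K]_n) (L : 'M[K]_n) :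
  M @ F --> L -> (fun t => \det (M t)) @ F --> \det L.
Proof.
move=> /cvg_mx ML; apply: cvg_big => [|s _]; first exact: add_continuous.
apply: cvgM; first exact: cvg_cst.
by apply: cvg_big => [|i _]; [exact: mul_continuous | exact: ML].
Qed.

(** Cramer's rule: the inverse is the adjugate divided by the determinant, which stays nonzero near
    the limit. *)
Lemma cvg_invmx n (M : T -> 'M[K]_n) (L : 'M[K]_n) :
  M @ F --> L -> L \in unitmx ->
  (\forall t \near F, M t \in unitmx) /\ (fun t => invmx (M t)) @ F --> invmx L.
Proof.
move=> ML uL; have dL : \det L != 0 by rewrite -unitfE.
have Mu : \forall t \near F, M t \in unitmx.
  have := @cvgr_neq0 K K T F FF _ _ (cvg_det ML) dL.
  by apply: filterS => t; rewrite unitmxE unitfE.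
split=> //; rewrite [invmx L]/invmx uL.
(* [invmx] returns singular matrices unchanged, so the adjugate formula is only available
   eventually. *)
apply: cvg_trans.
  apply: (near_eq_cvg (f := fun t => (\det (M t))^-1 *: \adj (M t))).
  by apply: filterS Mu => t ut; rewrite /invmx ut.
apply/cvg_mx => i j; rewrite !mxE.
under eq_cvg do rewrite !mxE.
apply: cvgM; first exact: cvgV (cvg_det ML).
apply: cvgM; first exact: cvg_cst.
apply: cvg_det; apply/cvg_mx => a b; rewrite !mxE.
under eq_cvg do rewrite !mxE.
exact: (proj2 (cvg_mx M L) ML).
Qed.

End MatrixLimits.

(** * Cutting off sections and bundle maps *)

Definition linear_map (K : numFieldType) (V W : lmodType K) (g : V -> W)
    (gl : linear g) : {linear V -> W} :=
  HB.pack g (GRing.isLinear.Build K V W *:%R g gl).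

Lemma continuous_comp2_at (T U V W : topologicalType) (h : U * V -> W)
    (f : T -> U) (g : T -> V) (x : T) :
  {for (f x, g x), continuous h} -> {for x, continuous f} ->
  {for x, continuous g} -> {for x, continuous (fun y => h (f y, g y))}.
Proof.
move=> ch cf cg; apply: (@continuous_comp _ _ _ (fun y => (f y, g y)) h) => //.
exact: (cvg_pair cf cg).
Qed.

(** A local trivialization records a linear [phi] with a bare inverse [psi]; this recovers the
    linearity of [psi]. *)
Lemma cancel_linear (K : numFieldType) (V W : lmodType K) (phi : {linear V -> W}) psi :
  cancel phi psi -> cancel psi phi -> linear psi.
Proof.
by move=> phiK psiK a u v; rewrite -{1}(psiK u) -{1}(psiK v) -linearP phiK.
Qed.

(** The complement of [C] is open and the product vanishes there, so [s] matters only at the points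
    of [C]. *)
Lemma scale_sec_cont (K : numFieldType) (B : topologicalType) (E : vbundle K B)
    (f : B -> K) (C : set B) (s : forall x, E x) :
    continuous f -> closed C -> (forall x, ~ C x -> f x = 0) ->
    (forall x, C x -> {for x, continuous (fun y => pt (s y))}) ->
  continuous (fun x => pt (f x *: s x)).
Proof.
move=> cf clC f0 cs; apply: local_sec_cont => x k U psi psil Ux cpsi oU.
have psiZ y a v : U y -> psi y (a *: v) = a *: psi y v.
  by move=> Uy; exact: (linearZ_LR (linear_map (psil y Uy))).
have [Cx|nCx] := pselect (C x).
  rewrite psiZ//; apply: cvg_trans.
    apply: (near_eq_cvg (f := fun y => f y *: psi y (s y))).
    by apply: filterS (open_nbhs_nbhs (conj oU Ux)) => y Uy; rewrite psiZ.
  exact: (cvgZ (cf x) (cpsi _ (cs x Cx))).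
rewrite f0// psiZ// scale0r.
apply: cvg_trans (@cvg_cst _ (0 : 'rV[K]_k) _ (nbhs x) _).
apply: near_eq_cvg.
have nC : nbhs x (~` C) by apply: open_nbhs_nbhs; split=> //; exact: closed_openC.
apply: filterS2 (open_nbhs_nbhs (conj oU Ux)) nC => y Uy Cy.
by rewrite f0// psiZ// scale0r.
Qed.

Section BundleMaps.
Context {K : numFieldType} {B : topologicalType}.
Implicit Types E F : vbundle K B.

(** The section constant in a trivialization is cut off by a bump function [f], then divided by
    [f x] to restore the value at [x]. *)
Lemma sections_at (bump : bump_functions K B) E x (v : E x) :
  exists sigma : sections E, sigma x = v.
Proof.
have [k [U [phi [psi [oU Ux phiK cphi _]]]]] := vb_triv E x.
have [f [C [cf _ fx clC [CU f0]]]] := bump x U (open_nbhs_nbhs (conj oU Ux)).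
have cs y : C y -> {for y, continuous (fun z => pt (phi z (psi x v)))}.
  move=> /CU Uy.
  exact: (continuous_comp2_at (cphi _ (psi x v) Uy) cvg_id (@cvg_cst _ _ _ _ _)).
exists ((f x)^-1 *: Sections (scale_sec_cont cf clC f0 cs)).
rewrite secZE /= scalerA mulVf ?gt_eqF// scale1r.
by case: (phiK x Ux) => _ ->.
Qed.

(* A fiberwise map E -> F is a section of the pullback of F to the total space of
   E, so sums and cut-offs of bundle maps reduce to those of sections. *)
Lemma fiberwise_cont E F (g : forall e : tot E, F (base e)) :
  continuous (fun e => pt (g e)) <->
  continuous (fun e => @pt _ _ (pullback (@vb_proj _ _ E) F) e (g e)).
Proof.
split=> cg e.
  by apply: pb_into; [exact: cvg_id | exact: cg].
exact: (@continuous_comp _ _ _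
  (fun e => @pt _ _ (pullback (@vb_proj _ _ E) F) e (g e)) _ e (cg e)
  (@pb_lift _ _ _ _ _ _)).
Qed.

Lemma bm_add_subproof E F (f g : bundle_map E F) :
  continuous (fun e : tot E => pt ((f (base e) \+ g (base e)) (vec e))).
Proof.
have cf := (fiberwise_cont _).1 (@bm_cont _ _ _ _ f).
have cg := (fiberwise_cont _).1 (@bm_cont _ _ _ _ g).
apply/fiberwise_cont; have := @sec_cont _ _ _ (Sections cf + Sections cg).
rewrite (_ : (fun e => _) = fun e => @pt _ _ (pullback (@vb_proj _ _ E) F) e
  ((f (base e) \+ g (base e)) (vec e)))//.
apply/funext => e.
exact: (congr1 (@pt _ _ (pullback (@vb_proj _ _ E) F) e) (secDE _ _ e)).
Qed.

Definition bm_add E F (f g : bundle_map E F) : bundle_map E F :=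
  BundleMap (bm_val := fun x => f x \+ g x) (@bm_add_subproof E F f g).

(** Extends a bundle map known only over [C] by zero: [scale_sec_cont] is applied on the total space
    of [E], to the pullback of [F]. *)
Lemma bump_bundle_map E F (f : B -> K) (C : set B) (g : forall x, E x -> F x) :
    continuous f -> closed C -> (forall x, ~ C x -> f x = 0) ->
    (forall x, C x -> linear (g x)) ->
    (forall e : tot E, C (base e) ->
       {for e, continuous (fun e : tot E => pt (g (base e) (vec e)))}) ->
  exists M : bundle_map E F, forall x v, M x v = f x *: g x v.
Proof.
move=> cf clC f0 gl cg.
have Ml x : linear (fun v => f x *: g x v).
  move=> a u v; have [Cx|/f0 ->] := pselect (C x); last by rewrite !scale0r scaler0 addr0.
  by rewrite gl// scalerDr !scalerA mulrC.
suff cM : continuous (fun e : tot E => pt (linear_map (Ml (base e)) (vec e))).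
  by exists (@BundleMap _ _ E F (fun x => linear_map (Ml x)) cM).
have cbase : continuous (fun e : tot E => base e) by exact: vb_proj.
apply/fiberwise_cont.
apply: (@scale_sec_cont _ _ (pullback (@vb_proj _ _ E) F) (fun e : tot E => f (base e))
  (fun e : tot E => C (base e)) (fun e => g (base e) (vec e))).
- move=> e.
  exact: (@continuous_comp _ _ _ (fun e : tot E => base e) f e (cbase e) (cf _)).
- exact: (closed_comp _ clC).
- by move=> e; exact: f0.
move=> e Ce; apply: pb_into; first exact: cvg_id.
exact: cg.
Qed.
End BundleMaps.

(** * Inverting bundle maps *)

Section InverseBundleMap.
Context {K : numFieldType} {B : topologicalType}.
Variables (E F : vbundle K B) (M : bundle_map E F).

(** In trivializations [M] is a matrix depending continuously on the base point, and matrix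
    inversion is continuous. *)
Lemma bm_inverse_near p0 : bijective (M p0) ->
  exists (U : set B) (inv : forall p, F p -> E p),
    [/\ open U, U p0,
        forall p, U p -> cancel (M p) (@inv p) /\ cancel (@inv p) (M p) &
        forall e : tot F, U (base e) ->
          {for e, continuous (fun e : tot F => pt (inv (base e) (vec e)))}].
Proof.
move=> [Mi MiK MKi].
have [k [UE [phi [psi [oUE UE0 phiK cphi cpsi]]]]] := vb_triv E p0.
have [l [UF [phi' [psi' [oUF UF0 phi'K cphi' cpsi']]]]] := vb_triv F p0.
(* The matrix A p of M p is not square a priori; P inverts A p0, so that A p *m P
   and P *m A p are square and invertible for p near p0. *)
pose A p := lin1_mx (fun v : 'rV[K]_k => psi' p (M p (phi p v))).
have AE p v : UF p -> v *m A p = psi' p (M p (phi p v)).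
  move=> /phi'K[phiK' psiK'].
  have Al : linear (fun v : 'rV[K]_k => psi' p (M p (phi p v))).
    by move=> a u w; rewrite !linearP (cancel_linear phiK' psiK').
  exact: (mul_rV_lin1 (linear_map Al)).
have cA p : UE p -> UF p -> A @ p --> A p.
  move=> UEp UFp; apply/cvg_mx => i j; rewrite mxE.
  under eq_cvg do rewrite mxE.
  (* Row [i] of [A q] is the image of the [i]-th basis vector, read in the trivialization of [F]. *)
  set v := delta_mx 0 i.
  have cphiv : {for p, continuous (fun q => pt (phi q v))}.
    exact: (continuous_comp2_at (cphi _ v UEp) cvg_id (@cvg_cst _ _ _ _ _)).
  have cMv : {for p, continuous (fun q => pt (M q (phi q v)))}.
    exact: (@continuous_comp _ _ _ _ _ p cphiv (@bm_cont _ _ _ _ M _)).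
  have cv := @continuous_comp _ _ _ (fun q => pt (M q (phi q v)))
     (fun e : tot F => psi' (base e) (vec e)) p cMv (cpsi' (pt (M p (phi p v))) UFp).
  exact: (proj2 (cvg_mx _ _) cv).
have [phi0K psi0K] := phiK p0 UE0.
have [phi'0K psi'0K] := phi'K p0 UF0.
have Pl : linear (fun w : 'rV[K]_l => psi p0 (Mi (phi' p0 w))).
  move=> a u w.
  by rewrite linearP (cancel_linear MiK MKi) (cancel_linear phi0K psi0K).
pose P := lin1_mx (linear_map Pl).
have AP0 : A p0 *m P = 1%:M.
  apply/row_matrixP => i; rewrite !rowE mulmxA AE// mul_rV_lin1 /=.
  by rewrite psi'0K MiK phi0K mulmx1.
have PA0 : P *m A p0 = 1%:M.
  apply/row_matrixP => i; rewrite !rowE mulmxA mul_rV_lin1 AE//=.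
  by rewrite psi0K MKi phi'0K mulmx1.
have APu p : UE p -> UF p -> A p *m P \in unitmx ->
    (\forall q \near p, A q *m P \in unitmx) /\
    (fun q => invmx (A q *m P)) @ p --> invmx (A p *m P).
  move=> UEp UFp; apply: cvg_invmx.
  by apply: cvg_mulmx; [exact: cA | exact: cvg_cst].
pose V := [set p | [/\ UE p, UF p, A p *m P \in unitmx & P *m A p \in unitmx]].
(* With matrices acting on row vectors, [P *m invmx (A p *m P)] is visibly a right inverse of
   [A p]. *)
pose inv p w := phi p (psi' p w *m (P *m invmx (A p *m P))).
exists V°, inv; split.
- exact: open_interior.
- have nE := open_nbhs_nbhs (conj oUE UE0).
  have nF := open_nbhs_nbhs (conj oUF UF0).
  have [nAP _] := APu p0 UE0 UF0 (eq_ind_r (fun C => C \in unitmx) (unitmx1 _ _) AP0).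
  have [||nPA _] := @cvg_invmx K B (nbhs p0) _ _ (fun q => P *m A q) (P *m A p0).
  + by apply: cvg_mulmx; [exact: cvg_cst | exact: cA].
  + by rewrite PA0 unitmx1.
  rewrite /interior /=; near=> q; split; near: q => //.
- move=> p /interior_subset[UEp UFp uAP uPA].
  have [phipK psipK] := phiK p UEp.
  have [phi'pK psi'pK] := phi'K p UFp.
  split=> [v|w].
    by rewrite /inv -{1}(psipK v) -AE// mulmxA -[X in X *m _]mulmxA mulmxK// psipK.
  apply: (can_inj psi'pK); rewrite -AE// -mulmxA.
  (* It is also a left inverse: both sides agree after multiplication on the left by the invertible
     [P *m A p]. *)
  suff -> : P *m invmx (A p *m P) *m A p = 1%:M by rewrite mulmx1.
  rewrite -[LHS](mulKmx uPA) -[RHS](mulKmx uPA); congr (_ *m _).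
  transitivity (P *m (A p *m P *m invmx (A p *m P)) *m A p); first by rewrite !mulmxA.
  by rewrite mulmxV// !mulmx1.
move=> e /interior_subset[UEe UFe uAP _].
have cb : {for e, continuous (fun e : tot F => base e)} by exact: vb_proj.
have [_ ci] := APu _ UEe UFe uAP.
have cX := @continuous_comp _ _ _ (fun e : tot F => base e) (fun q => invmx (A q *m P)) e cb ci.
have cu : {for e, continuous (fun e : tot F =>
    psi' (base e) (vec e) *m (P *m invmx (A (base e) *m P)))}.
  exact: (cvg_mulmx (cpsi' e UFe) (cvg_mulmx (@cvg_cst _ P _ (nbhs e) _) cX)).
exact: (@continuous_comp2_at _ _ _ _ (fun q : B * 'rV[K]_k => pt (phi q.1 q.2))
  (fun e : tot F => base e) _ e (cphi _ _ UEe) cb cu).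
Unshelve. all: by end_near. Qed.

End InverseBundleMap.

(** Inverses are unique, so the local inverses agree with one pointwise choice, which inherits their
    continuity. *)
Lemma bm_inverse (K : numFieldType) (B : topologicalType) (E F : vbundle K B)
    (M : bundle_map E F) :
  exists inv : forall p, F p -> E p,
    [/\ open [set p | bijective (M p)],
        forall p, bijective (M p) -> cancel (M p) (@inv p) /\ cancel (@inv p) (M p) &
        forall e : tot F, bijective (M (base e)) ->
          {for e, continuous (fun e : tot F => pt (inv (base e) (vec e)))}].
Proof.
(* The default 0 is taken only where [w] has no preimage, which cannot happen when [M p] is
   bijective. *)
pose inv p w := xget 0 [set v | M p v = w].
have invE p g : cancel (M p) g -> cancel g (M p) -> inv p =1 g.
  move=> MK gK w; apply: (can_inj MK); rewrite gK.
  by apply: (@xgetPex _ 0 [set v | M p v = w]); exists (g w); exact: gK.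
exists inv; split.
- rewrite openE => p /bm_inverse_near[U [g [oU Up gK _]]].
  apply: filterS (open_nbhs_nbhs (conj oU Up)) => q /gK[MK gMK].
  exact: Bijective MK gMK.
- by move=> p [g MK gK]; split=> v; rewrite (invE p g)//.
move=> e /bm_inverse_near[U [g [oU Ue gK cg]]].
have [MK gMK] := gK _ Ue.
have : nbhs e ((fun e : tot F => base e) @^-1` U).
  exact: (@vb_proj _ _ F e _ (open_nbhs_nbhs (conj oU Ue))).
move=> nU; rewrite /prop_for /continuous_at (invE _ _ MK gMK).
move=> A /(cg e Ue); apply: (@filterS2 _ (nbhs e)) nU => e' /= /gK[MK' gMK'].
by rewrite (invE _ _ MK' gMK').
Qed.

(** * Gauge charts around every point of [X] *)

(** The tube lemma, read off from the near-covering form of compactness. *)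
Lemma compact_tube (X N : topologicalType) (A : set N) (W : set (X * N)) (b : X) :
  compact A -> (forall n, A n -> nbhs (b, n) W) ->
  \forall b' \near b, forall n, A n -> W (b', n).
Proof.
move=> /compact_near_coveringP cA bW.
apply: (cA X (nbhs b) (fun b' n => W (b', n))) => n /bW[[P Q] [Pb Qn] PQW].
by exists (Q, P) => // -[n' b'] [/= Qn' Pb']; exact: PQW.
Qed.

Section GaugeCharts.
Context {K : numFieldType} {X N : topologicalType}.
Hypotheses (bump : bump_functions K (X * N)%type) (N_compact : compact [set: N]).
Variables (E : vbundle K (X * N)%type) (b : X).

Let r (p : X * N) : X * N := (b, p.2).

Let r_cont : continuous r.
Proof.
by move=> p; exact: (continuous_comp (@cvg_snd _ _ _ _ _) (@slice_cont _ _ b _)).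
Qed.

(* The family over X x N that is constant in X with value E_b. *)
Let E' : vbundle K (X * N)%type := pullback r_cont E.

(** Only the behavior over [{b} x N] is constrained, where [E'] and [E] have the same fibers. Such
    maps can be added, which isomorphisms do not allow. *)
Let scales (c : N -> K) := (forall n, 0 <= c n) /\
  exists M : bundle_map E' E, forall n (v : E (b, n)), M (b, n) v = c n *: v.

(** A trivialization around [(b, n)] carries vectors at [(b, n')] to vectors at [(b', n')] with the
    same coordinates; for [b' = b] this is the identity, here multiplied by a bump function. *)
Let scales_near (n : N) : exists2 c, scales c & \forall n' \near n, 0 < c n'.
Proof.
have [k [U [phi [psi [oU Un phiK cphi cpsi]]]]] := vb_triv E (b, n).
(* Both [p] and [r p] must lie in the trivializing set; this holds at [(b, n)], which [r] fixes. *)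
have nU : nbhs (b, n) (U `&` r @^-1` U).
  apply: open_nbhs_nbhs; split=> //; apply: openI => //.
  by apply: open_comp => // p _; exact: r_cont.
have [f [C [cf f_ge0 fn clC [CU f0]]]] := bump nU.
have gl p : C p -> linear (fun v : E' p => phi p (psi (r p) v)).
  move=> /CU[_ /phiK[rK Kr]] a u v.
  by rewrite (cancel_linear rK Kr) linearP.
have cg (e : tot E') : C (base e) ->
    {for e, continuous (fun e : tot E' => pt (phi (base e) (psi (r (base e)) (vec e))))}.
  move=> /CU[Up Urp].
  have cb : {for e, continuous (fun e : tot E' => base e)} by exact: vb_proj.
  have cl : {for e, continuous (fun e : tot E' => @pt _ _ E (r (base e)) (vec e))}.
    exact: pb_lift.
  have cp := @continuous_comp _ _ _ (fun e : tot E' => @pt _ _ E (r (base e)) (vec e))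
    (fun e : tot E => psi (base e) (vec e)) e cl
    (cpsi (@pt _ _ E (r (base e)) (vec e)) Urp).
  exact: (@continuous_comp2_at _ _ _ _ (fun q : (X * N) * 'rV[K]_k => pt (phi q.1 q.2))
    (fun e : tot E' => base e) _ e (cphi _ _ Up) cb cp).
have [M ME] := bump_bundle_map cf clC f0 gl cg.
exists (fun n' => f (b, n')).
  split=> //; exists M => n' v; rewrite ME.
  have [/CU[Up _]|/f0 ->] := pselect (C (b, n')); last by rewrite !scale0r.
  by have [_ ->] := phiK _ Up.
have cfb : (fun n' => f (b, n')) @ n --> f (b, n).
  exact: (@continuous_comp _ _ _ (fun n' : N => (b, n')) f n (@slice_cont _ _ b n) (cf _)).
have fn0 : \forall n' \near n, f (b, n') != 0.
  exact: (@cvgr_neq0 K K N (nbhs n) _ _ _ cfb (lt0r_neq0 fn)).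
by apply: filterS fn0 => n' fn'; rewrite lt0r fn' f_ge0.
Qed.

Let scales_pos : exists2 c, scales c & forall n, 0 < c n.
Proof.
have /choice[c_ c_P] (n : N) : exists c, scales c /\ \forall n' \near n, 0 < c n'.
  by have [c] := scales_near n; exists c.
have sum (s : seq N) : exists2 c, scales c &
    forall i n, i \in s -> 0 < c_ i n -> 0 < c n.
  elim: s => [|i s [c [c_ge0 [M ME]] cP]].
    exists (fun=> 0) => //; split=> //.
    have [|||||M ME] := @bump_bundle_map _ _ E' E (fun=> 0) set0 (fun _ _ => 0).
    - by move=> x; exact: cvg_cst.
    - exact: closed0.
    - by [].
    - by [].
    - by [].
    by exists M => n v; rewrite ME !scale0r.
  have [[ci_ge0 [Mi MiE]] _] := c_P i.
  exists (fun n => c_ i n + c n).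
    split=> [n|]; first exact: addr_ge0.
    by exists (bm_add Mi M) => n v; rewrite /= scalerDl -MiE -ME.
  move=> j n; rewrite inE => /predU1P[->|js] cj; first exact: ltr_wpDr.
  by apply: ltr_wpDl => //; exact: cP cj.
(* The filter is that of finite lists ordered by inclusion: a list eventually contains any given
   point. Compactness yields a single list [s] such that every [n] has some [i] in [s] with
   [c_ i n > 0]. *)
have := (compact_near_coveringP [set: N]).1 N_compact (seq N)
  (filter_from setT (fun s0 : seq N => [set s : seq N | {subset s0 <= s}]))
  (fun (s : seq N) n => exists2 i, i \in s & 0 < c_ i n).
case.
- apply: filter_from_filter; first by exists [::].
  move=> s s' _ _; exists (s ++ s') => // t st; split=> i si; apply: st;
    by rewrite mem_cat si ?orbT.
- move=> n _; have [_ cn] := c_P n.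
  exists ([set n' | 0 < c_ n n'], [set s : seq N | {subset [:: n] <= s}]).
    by split=> //; exists [:: n].
  by move=> [n' s] /= [cn' ns]; exists n => //; apply: ns; rewrite mem_head.
- move=> s _ /(_ s (fun _ => id)) sP.
  have [c cs cP] := sum s; exists c => // n.
  by have [i si ci] := sP n I; exact: cP ci.
Qed.

Lemma gauge_chart_at : exists c : gauge_chart E (slice E b), gc_dom c b.
Proof.
have [c [_ [M ME]] c_gt0] := scales_pos.
have [inv [oW invK cinv]] := bm_inverse M.
pose W := [set p | bijective (M p)].
have bW n : W (b, n).
  have cn := lt0r_neq0 (c_gt0 n).
  exists (fun v : E (b, n) => (c n)^-1 *: v) => v; rewrite ME scalerA ?mulVf ?mulfV// scale1r//.
pose U := [set b' | forall n, W (b', n)].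
have nU : nbhs b U.
  have : \forall b' \near b, forall n, [set: N] n -> W (b', n).
    by apply: compact_tube => // n _; apply: open_nbhs_nbhs; split.
  by apply: filterS => b' VW n; exact: VW.
have UW b' : U° b' -> forall n, W (b', n) by move=> /interior_subset Ub' n; exact: Ub'.
unshelve eexists.
  apply: (@GaugeChart K X N E (slice E b) U° (fun x => M x) inv).
  - exact: open_interior.
  - by move=> [b' n] /= /UW Wb'; exact: (invK _ (Wb' n)).
  - move=> b' e _.
    (* A vector of [E_b] over [n], paired with [b'], is a vector of [E'] over [(b', n)], to which
       [M] applies. *)
    have cE' : {for (b', e), continuous (fun p : X * tot (slice E b) =>
        @pt _ _ E' (p.1, base p.2) (vec p.2))}.
      have cb : {for (b', e), continuous (fun p : X * tot (slice E b) => base p.2)}.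
        exact: (@continuous_comp _ _ _ snd (fun e : tot (slice E b) => base e) (b', e)
          (@cvg_snd _ _ _ _ _) (@vb_proj _ _ (slice E b) e)).
      apply: pb_into.
        exact: (cvg_pair (@cvg_fst _ _ _ _ _) cb).
      exact: (@continuous_comp _ _ _ snd
        (fun e : tot (slice E b) => @pt _ _ E (b, base e) (vec e)) (b', e)
          (@cvg_snd _ _ _ _ _) (@pb_lift _ _ _ _ E e)).
    exact: (@continuous_comp _ _ _ _ _ (b', e) cE' (@bm_cont _ _ _ _ M _)).
  - move=> e Ue.
    have We : W (base e) by case: (base e) Ue => b' n /= /UW.
    apply: pb_into.
      exact: (@continuous_comp _ _ _ (fun e : tot E => base e) snd e
        (@vb_proj _ _ E e) (@cvg_snd _ _ _ _ _)).
    (* Conversely a vector of [E'] over [p] is a vector of [E] over [r p], hence of [E_b]. *)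
    have cl : {for @pt _ _ E' (base e) (inv (base e) (vec e)),
        continuous (fun e : tot E' => @pt _ _ E (r (base e)) (vec e))}.
      exact: pb_lift.
    exact: (@continuous_comp _ _ _
      (fun e : tot E => @pt _ _ E' (base e) (inv (base e) (vec e))) _ e (cinv e We) cl).
exact: nU.
Qed.

End GaugeCharts.

(** * The compact-open topology on sections *)

Lemma compact_nbhs (T : topologicalType) (x : T) (A : set T) :
  hausdorff_space T -> compact [set: T] -> nbhs x A ->
  exists C, [/\ compact C, nbhs x C & C `<=` A].
Proof.
move=> hT cT Ax; have [V Vx VA] := compact_regular hT cT filterT Ax.
exists (closure V); split=> //; last by apply: filterS Vx; exact: subset_closure.
by apply: (subclosed_compact _ cT) => //; exact: closed_closure.
Qed.

Section SectionTopology.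
Context {K : numFieldType} {N : topologicalType}.
Variable E : vbundle K N.

(** One half of the exponential law: for each compact [C], the tube lemma makes the condition of
    mapping [C] into an open set hold near [t]. *)
Lemma sections_continuous_at (T : topologicalType) (s : T -> sections E) (t : T) :
  (forall n, {for (t, n), continuous (fun p : T * N => pt (s p.1 p.2))}) ->
  {for t, continuous s}.
Proof.
move=> cs A [W [[V oV <-] Vst VA]].
have cS : (fun u => sec_fun (s u)) @ t --> sec_fun (s t).
  apply/compact_open_cvgP => C O cC oO sO.
  have : \forall u \near t, forall n, C n -> O (pt (s u n)).
    apply: (@compact_tube _ _ C [set p | O (pt (s p.1 p.2))]) => // n Cn.
    by apply: cs; apply: open_nbhs_nbhs; split=> //; apply: sO; exists n.
  by apply: filterS => u uO _ [n Cn <-]; exact: uO.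
apply: (@filterS _ (nbhs t) _ _ _ _ (cS V (open_nbhs_nbhs (conj oV Vst)))) => u Vu.
exact: VA.
Qed.

(** The other half: [n] has a compact neighborhood [C] that [s] maps into [Q], and mapping [C] into
    [Q] is an open condition on sections. *)
Lemma sec_eval_continuous : hausdorff_space N -> compact [set: N] ->
  continuous (fun p : sections E * N => pt (p.1 p.2)).
Proof.
move=> hN cN [s n] A [Q [oQ Qsn QA]].
have [C [cC Cn CQ]] : exists C, [/\ compact C, nbhs n C & C `<=` (fun m => pt (s m)) @^-1` Q].
  by apply: compact_nbhs => //; apply: (@sec_cont _ _ _ s); exact: open_nbhs_nbhs.
exists ((@sec_fun _ _ E) @^-1` [set g | g @` C `<=` Q], C).
  split=> //=; apply: (@initial_continuous _ _ (@sec_fun _ _ E)).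
  apply: open_nbhs_nbhs; split; first exact: compact_open_open.
  by move=> _ [m Cm <-]; exact: CQ.
by move=> [s' m] /= [s'C Cm]; apply: QA; apply: s'C; exists m.
Qed.

End SectionTopology.

(** * The canonical identification *)

Section Identification.
Context {K : numFieldType} {X N : topologicalType}.
Hypotheses (N_hausdorff : hausdorff_space N) (N_compact : compact [set: N]).

Lemma sub_push_family (E : vbundle K (X * N)%type) :
  push_sections E `<=` family_sections E.
Proof.
move=> h ch.
suff cs : continuous (fun p : X * N =>
    pt (let: (b, n) as p := p return E p in h b n : E (b, n))).
  by exists (Sections cs).
move=> [b n] A [Q [oQ Qbn QA]].
have [C [cC Cn CQ]] : exists C, [/\ compact C, nbhs n C &
    C `<=` [set m | Q (@pt _ _ E (b, m) (h b m))]].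
  apply: compact_nbhs => //.
  have cb := @continuous_comp _ _ _ _ _ n (@sec_cont _ _ _ (h b) n)
    (@pb_lift _ _ _ _ E (pt (h b n))).
  by apply: cb; exact: open_nbhs_nbhs.
pose W := [set e : tot (Defs.pushforward E) |
  forall m, C m -> Q (@pt _ _ E (base e, m) (vec e m))].
have oW : @open (tot (Defs.pushforward E)) W.
  move=> E0 c; rewrite openE => -[b' s] [/= Ub' [t [tE Wt]]].
  (* Openness is tested in the chart [c]: evaluation followed by [gc_map c] is jointly continuous,
     and the tube lemma makes the condition uniform over [C]. *)
  have near_Q : \forall p \near (b', s), forall m, C m ->
      Q (pt (gc_map c (p.1, m) ((p.2 : sections E0) m))).
    apply: (@compact_tube _ _ C
      [set q : (X * sections E0) * N | Q (pt (gc_map c (q.1.1, q.2) (q.1.2 q.2)))]) => //.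
    move=> m Cm.
    have c1 : {for ((b', s), m), continuous (fun q : (X * sections E0) * N => q.1.1)}.
      exact: (@continuous_comp _ _ _ fst fst ((b', s), m) cvg_fst cvg_fst).
    have c2 : {for ((b', s), m), continuous (fun q : (X * sections E0) * N => q.1.2)}.
      exact: (@continuous_comp _ _ _ fst snd ((b', s), m) cvg_fst cvg_snd).
    have c3 : {for ((b', s), m), continuous (fun q : (X * sections E0) * N => pt (q.1.2 q.2))}.
      exact: (@continuous_comp2_at _ _ _ _ (fun p : sections E0 * N => pt (p.1 p.2))
        _ snd ((b', s), m) (@sec_eval_continuous _ _ E0 N_hausdorff N_compact _) c2 cvg_snd).
    have c4 := @continuous_comp2_at _ _ _ _
      (fun p : X * tot E0 => pt (gc_map c (p.1, base p.2) (vec p.2))) _ _ _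
      (@gc_map_cont _ _ _ _ _ c b' (pt (s m)) Ub') c1 c3.
    apply: c4; apply: open_nbhs_nbhs; split=> //=.
    by rewrite -tE; exact: Wt.
  have near_U : \forall p \near (b', s), gc_dom c p.1.
    apply: (@cvg_fst _ _ (nbhs b') (nbhs s)); apply: open_nbhs_nbhs; split=> //.
    exact: gc_open.
  apply: filterS2 near_Q near_U => -[b'' s'] /= sQ Ub''; split=> //=.
  by exists (Sections (@chart_sec_cont _ _ _ _ _ c b'' s' Ub'')); split.
have nW : \forall b' \near b, W (@pt _ _ (Defs.pushforward E) b' (h b')).
  by apply: ch; apply: open_nbhs_nbhs; split=> // m Cm; exact: CQ.
exists ([set b' | W (@pt _ _ (Defs.pushforward E) b' (h b'))], C) => //.
by move=> [b' m] /= [Wb' Cm]; apply: QA; exact: Wb'.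
Qed.

(** In a chart at [b], the family becomes a map into the fixed space of sections of [E_b],
    continuous because [sigma] is jointly continuous. *)
Lemma sub_family_push (bump : bump_functions K (X * N)%type)
    (E : vbundle K (X * N)%type) :
  family_sections E `<=` push_sections E.
Proof.
move=> h [sigma hE] b A [W [oW Wb WA]].
have [c Ub] := gauge_chart_at bump N_compact E b.
have csig b' n : gc_dom c b' ->
    {for (b', n), continuous (fun p => pt (gc_inv c (sigma p)))}.
  move=> Ub'.
  exact: (@continuous_comp _ _ _ (fun p => pt (sigma p))
    (fun e : tot E => pt (gc_inv c (vec e))) (b', n) (@sec_cont _ _ _ sigma _)
    (@gc_inv_cont _ _ _ _ _ c (pt (sigma (b', n))) Ub')).
have cs b' : gc_dom c b' -> continuous (fun n => pt (gc_inv c (sigma (b', n)))).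
  move=> Ub' n; exact: (@continuous_comp _ _ _ (fun n : N => (b', n)) _ n
    (@slice_cont _ _ b' n) (csig b' n Ub')).
(* The value 0 off the chart domain only makes [s] total; the domain is a neighborhood of [b]. *)
pose s b' : sections (slice E b) :=
  if pselect (gc_dom c b') is left Ub' then Sections (cs b' Ub') else 0.
have sE b' n : gc_dom c b' -> s b' n = gc_inv c (sigma (b', n)).
  by rewrite /s; case: pselect.
have U_near (b' : X) : gc_dom c b' -> nbhs b' (gc_dom c).
  by move=> Ub'; apply: open_nbhs_nbhs; split=> //; exact: gc_open.
have cts : {for b, continuous s}.
  apply: sections_continuous_at => n.
  have : \forall p \near (b, n), gc_dom c p.1.
    by apply: (@cvg_fst _ _ (nbhs b) (nbhs n)); exact: U_near.
  move=> nU; rewrite /prop_for /continuous_at /= (sE b n Ub).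
  move=> Q /(csig b n Ub); apply: (@filterS2 _ (nbhs (b, n))) nU => -[b' n'] /= Ub'.
  by rewrite sE.
have := @oW _ c; rewrite openE => oP.
have cp : (fun b' => (b', s b')) @ b --> (b, s b) by exact: (cvg_pair cvg_id cts).
(* The chart takes [s b'] back to [h b'], so the section witnessing membership in the chart preimage
   is [h b'] itself. *)
have sub b' t : chart_preimage c W (b', t) -> (forall n, t n = gc_inv c (sigma (b', n))) ->
    W (@pt _ _ (Defs.pushforward E) b' (h b')).
  move=> [/= Ub' [t' [t'E Wt']]] tE.
  rewrite (_ : h b' = t')//; apply: sectionsP => n; rewrite t'E tE hE.
  by have [_ ->] := @gc_mapK _ _ _ _ _ c (b', n) Ub'.
have Pb : chart_preimage c W (b, s b).
  split=> //; exists (h b); split=> // n; rewrite sE// hE.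
  by have [_ ->] := @gc_mapK _ _ _ _ _ c (b, n) Ub.
apply: (@filterS2 _ (nbhs b)) (U_near b Ub) (cp _ (oP _ Pb)) => b' Ub' Pb'.
by apply/WA/(sub b' (s b')) => // n; exact: sE.
Qed.

Lemma push_sections_family (bump : bump_functions K (X * N)%type) :
  canonical_identification K X N.
Proof.
by move=> E; apply/seteqP; split; [exact: sub_push_family | exact: sub_family_push].
Qed.

End Identification.

(** * The equivalence of categories *)

Section Equivalence.
Context {K : numFieldType} {X N : topologicalType}.
Hypotheses (bump : bump_functions K (X * N)%type)
  (ident : canonical_identification K X N).
Implicit Types S T U : @gspace K X N.

Definition induces S T (f : gs_elt S -> gs_elt T)
    (phi : bundle_map (gs_bundle S) (gs_bundle T)) :=
  forall h b, proj1_sig (f h) b = push_map phi b (proj1_sig h b).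

Lemma slice_sec_cont (E : vbundle K (X * N)%type) (sigma : sections E) b :
  continuous (fun n => @pt _ _ (slice E b) n (sigma (b, n))).
Proof.
move=> n; apply: pb_into; first exact: cvg_id.
exact: (@continuous_comp _ _ _ (fun n : N => (b, n)) (fun p => pt (sigma p)) n
  (@slice_cont _ _ b n) (@sec_cont _ _ _ sigma _)).
Qed.

(** At [n] both sides depend only on the vector [s n]. A global section through that vector gives an
    element of [S], on which [f] determines both. *)
Lemma induces_unique S T (f : gs_elt S -> gs_elt T) phi psi :
  induces f phi -> induces f psi -> forall b s, push_map phi b s = push_map psi b s.
Proof.
move=> fphi fpsi b s; apply: sectionsP => n /=.
have [sigma <-] := sections_at bump (s n : gs_bundle S (b, n)).
pose h b' := Sections (@slice_sec_cont _ sigma b').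
have hS : @gs_space _ _ _ S h by rewrite gs_spaceE; exists sigma.
have := fphi (exist _ h hS) b; rewrite fpsi => /(congr1 (fun t => sec_val t n)).
by [].
Qed.

Definition inducing S T (f : gshom S T) := projT1 (cid (gs_ind f)).

Lemma inducingP S T (f : gshom S T) : induces f (inducing f).
Proof. exact: projT2 (cid (gs_ind f)). Qed.

Lemma underlying_map_ind S T (f : gshom S T) :
  exists phi : bundle_map (gs_bundle S) (gs_bundle T),
    forall b s, push_map (inducing f) b s = push_map phi b s.
Proof. by exists (inducing f). Qed.

Definition underlying_map S T (f : gshom S T) : ghom (gs_bundle S) (gs_bundle T) :=
  GHom (underlying_map_ind f).

(** Removes the dependence on the bundle map chosen by [inducing], which is what makes
    [underlying_map] functorial. *)
Lemma underlying_mapE S T (f : gshom S T) phi : induces f phi ->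
  forall b s, underlying_map f b s = push_map phi b s.
Proof. by move=> fphi b s; exact: induces_unique (inducingP f) fphi b s. Qed.

Lemma underlying_map1 S : underlying_map (gshom_id S) = ghom_id (gs_bundle S).
Proof.
apply: ghomP => b s; rewrite (@underlying_mapE _ _ _ (bm_id _)).
  exact: sectionsP.
by move=> h b'; exact: sectionsP.
Qed.

Lemma underlying_mapM S T U (g : gshom T U) (f : gshom S T) :
  underlying_map (gshom_comp g f) = ghom_comp (underlying_map g) (underlying_map f).
Proof.
apply: ghomP => b s.
rewrite (@underlying_mapE _ _ _ (bm_comp (inducing g) (inducing f))).
  exact: sectionsP.
by move=> h b'; rewrite /= !inducingP; exact: sectionsP.
Qed.

Definition underlying_bundle : functor (GammaV K X N) (VectG K X N) :=
  @Functor (GammaV K X N) (VectG K X N) (@gs_bundle _ _ _) underlying_map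
    underlying_map1 underlying_mapM.

Lemma gs_space_ident S : push_sections (gs_bundle S) = @gs_space _ _ _ S.
Proof. by rewrite gs_spaceE ident. Qed.

Let F := global_sections ident.

(** An object of [GammaV] has its space only up to a proved equality, so membership is transported
    along it while the family stays the same. *)
Definition from_global_sections S (h : gs_elt (F (gs_bundle S))) : gs_elt S :=
  exist _ (proj1_sig h) (eq_ind _ (fun A => A _) (proj2_sig h) _ (gs_space_ident S)).

Definition to_global_sections S (h : gs_elt S) : gs_elt (F (gs_bundle S)) :=
  exist _ (proj1_sig h) (eq_ind_r (fun A => A _) (proj2_sig h) (gs_space_ident S)).

Lemma from_induced S : gs_induced (@from_global_sections S).
Proof. by exists (bm_id _) => h b; exact: sectionsP. Qed.

Lemma to_induced S : gs_induced (@to_global_sections S).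
Proof. by exists (bm_id _) => h b; exact: sectionsP. Qed.

Lemma global_sections_equivalence : is_equivalence F.
Proof.
exists underlying_bundle; split.
(* The round trip returns the same bundle, so identities serve as components; naturality says that
   [f] is recovered from its action on global sections. *)
- exists (fun E => ghom_id E), (fun E => ghom_id E); split.
    by move=> E; split; exact: ghomP.
  move=> E E' f; apply: ghomP => b s /=.
  have [phi fE] := ghom_ind f.
  rewrite fE; apply: (@underlying_mapE _ _ (global_sections_map ident f) phi) => h b'.
  by rewrite /= fE.
- exists (fun S => GSHom (@from_induced S)), (fun S => GSHom (@to_induced S)); split.
    by move=> S; split; apply: gshomP => h; exact: gs_eltP.
  move=> S T f; apply: gshomP => h; apply: gs_eltP => /=.
  apply/functional_extensionality_dep => b.
  by rewrite inducingP.
Qed.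

End Equivalence.

Theorem theorem10 (R : realType) (d m : nat) (X N : topologicalType)
    (X_manifold : manifold_with_boundary R d X) (X_compact : compact [set: X])
    (gN : riemannian_manifold R m N) (N_closed : compact [set: N])
    (N_orientable : orientable gN) :
  exists ident : canonical_identification (R[i] : numFieldType) X N,
    is_equivalence (global_sections ident).
Proof.
have hX : hausdorff_space X by case: X_manifold.
have hN : hausdorff_space N := rm_hausdorff gN.
have cXN : compact [set: X * N] by rewrite -setXTT; exact: compact_setX.
(* [X * N] is compact Hausdorff as a product of two such spaces. *)
have bump : bump_functions (R[i] : numFieldType) (X * N)%type.
  by apply: compact_bump_functions => //; exact: hausdorff_setX.
exists (push_sections_family hN N_closed bump).
exact: global_sections_equivalence.
Qed.
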